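(* Let $k$ be a field of characteristic $\neq 2$ and let $\mathfrak{g}$ be a non-abelian Lie algebra over $k$. Then there is no nontrivial Poisson Hopf structure on the universal enveloping algebra $U(\mathfrak{g})$; that is, if $\{-,-\}: U(\mathfrak{g})\otimes U(\mathfrak{g})\to U(\mathfrak{g})$ is a linear map making the Hopf algebra $U(\mathfrak{g})$ into a Poisson Hopf algebra, then $\{-,-\}=0$.
   Context: All vector spaces, algebras and tensor products are over $k$. Algebras are not assumed commutative. A Poisson algebra is an algebra $A$ with a linear map $\{-,-\}:A\otimes A\to A$ such that $(A,\{-,-\})$ is a Lie algebra and $\{ab,c\}=a\{b,c\}+\{a,c\}b$ for all $a,b,c\in A$. A Poisson Hopf algebra is a Hopf algebra $H$ with comultiplication $\Delta$ (Sweedler notation $\Delta(a)=\sum a_1\otimes a_2$) and a linear map $\{-,-\}:H\otimes H\to H$ such that $(H,\{-,-\})$ is a Poisson algebra and $\Delta(\{a,b\})=\sum\{a_1,b_1\}\otimes a_2b_2+\sum a_1b_1\otimes\{a_2,b_2\}$ for all $a,b\in H$. Such a structure is nontrivial if the bracket is not identically zero. $U(\mathfrak{g})$ carries its standard Hopf algebra structure, in which elements of $\mathfrak{g}$ are primitive. *)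

(* Defs.v *)
From HB Require Import structures.
From mathcomp Require Import all_boot all_algebra.
From mathcomp.classical Require Import boolp.

Set Implicit Arguments.
Unset Strict Implicit.
Unset Printing Implicit Defensive.

Import GRing.Theory.
Local Open Scope quotient_scope.
Local Open Scope ring_scope.

Reserved Notation "x ⊗ y" (at level 40, left associativity).

(** * Tensor products of vector spaces *)

(* [tensor V W] is the vector space generated by the symbols [TPure v w] subject   *)
(* to bilinearity: formal expressions modulo the congruence [teq] generated   *)
(* by the vector space axioms and the bilinearity relations.  Zero and        *)
(* opposites are [TPure 0 0] and [TScale (-1) _].                             *)
Section TensorDef.
Variables (k : fieldType) (V W : lmodType k).

Inductive tterm : Type :=
| TPure of V & W
| TAdd of tterm & tterm
| TScale of k & tterm.

Inductive teq : tterm -> tterm -> Prop :=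
| teq_refl t : teq t t
| teq_sym s t : teq s t -> teq t s
| teq_trans s t u : teq s t -> teq t u -> teq s u
| teq_add s s' t t' : teq s s' -> teq t t' -> teq (TAdd s t) (TAdd s' t')
| teq_scale a t t' : teq t t' -> teq (TScale a t) (TScale a t')
| teq_addA s t u : teq (TAdd s (TAdd t u)) (TAdd (TAdd s t) u)
| teq_addC s t : teq (TAdd s t) (TAdd t s)
| teq_scaleA a b t : teq (TScale a (TScale b t)) (TScale (a * b) t)
| teq_scale1 t : teq (TScale 1 t) t
| teq_scale0 t : teq (TScale 0 t) (TPure 0 0)
| teq_scaleDr a s t : teq (TScale a (TAdd s t)) (TAdd (TScale a s) (TScale a t))
| teq_scaleDl a b t : teq (TScale (a + b) t) (TAdd (TScale a t) (TScale b t))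
| teq_pureDl v v' w : teq (TPure (v + v') w) (TAdd (TPure v w) (TPure v' w))
| teq_pureDr v w w' : teq (TPure v (w + w')) (TAdd (TPure v w) (TPure v w'))
| teq_pureZl a v w : teq (TPure (a *: v) w) (TScale a (TPure v w))
| teq_pureZr a v w : teq (TPure v (a *: w)) (TScale a (TPure v w)).

HB.instance Definition _ := gen_eqMixin tterm.
HB.instance Definition _ := gen_choiceMixin tterm.

Definition teqb (s t : tterm) : bool := `[< teq s t >].

Fact teqb_refl : reflexive teqb.
Proof. by move=> t; apply/asboolP/teq_refl. Qed.

Fact teqb_sym : symmetric teqb.
Proof. by move=> s t; apply/asboolP/asboolP=> /teq_sym. Qed.

Fact teqb_trans : transitive teqb.
Proof.
by move=> t s u /asboolP st /asboolP tu; apply/asboolP/(teq_trans st tu).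
Qed.

Definition teq_equiv := EquivRel teqb teqb_refl teqb_sym teqb_trans.

Definition tensor : Type := {eq_quot teq_equiv}.

HB.instance Definition _ := Choice.copy tensor {eq_quot teq_equiv}.

Definition tpi (t : tterm) : tensor := \pi_({eq_quot teq_equiv}) t.
Definition trepr (x : tensor) : tterm := repr (x : {eq_quot teq_equiv}).

Lemma treprK x : tpi (trepr x) = x.
Proof. exact: reprK. Qed.

Lemma tpiP s t : tpi s = tpi t <-> teq s t.
Proof.
have P := @eqmodP _ teq_equiv s t.
by split=> [/P /asboolP|/asboolP /P].
Qed.

Lemma trepr_pi t : teq (trepr (tpi t)) t.
Proof. by apply/tpiP; rewrite treprK. Qed.

Definition tens (v : V) (w : W) : tensor := tpi (TPure v w).
Definition tensor_zero : tensor := tens 0 0.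
Definition tensor_add (x y : tensor) : tensor := tpi (TAdd (trepr x) (trepr y)).
Definition tensor_scale (a : k) (x : tensor) : tensor :=
  tpi (TScale a (trepr x)).

Lemma tpi_add s t : tpi (TAdd s t) = tensor_add (tpi s) (tpi t).
Proof. by apply/tpiP/teq_add; apply/teq_sym/trepr_pi. Qed.

Lemma tpi_scale a t : tpi (TScale a t) = tensor_scale a (tpi t).
Proof. by apply/tpiP/teq_scale/teq_sym/trepr_pi. Qed.

Fact tensor_addA : associative tensor_add.
Proof.
move=> x y z; rewrite -[x]treprK -[y]treprK -[z]treprK -!tpi_add.
exact/tpiP/teq_addA.
Qed.

Fact tensor_addC : commutative tensor_add.
Proof.
by move=> x y; rewrite -[x]treprK -[y]treprK -!tpi_add; apply/tpiP/teq_addC.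
Qed.

Fact tensor_scale1 : left_id 1 tensor_scale.
Proof. by move=> x; rewrite -[x]treprK -tpi_scale; apply/tpiP/teq_scale1. Qed.

Fact tensor_scale0 x : tensor_scale 0 x = tensor_zero.
Proof. by rewrite -[x]treprK -tpi_scale; apply/tpiP/teq_scale0. Qed.

Fact tensor_scaleDl x : {morph tensor_scale^~ x : a b / a + b >-> tensor_add a b}.
Proof.
by move=> a b; rewrite -[x]treprK -!tpi_scale -tpi_add; apply/tpiP/teq_scaleDl.
Qed.

Fact tensor_scaleDr : right_distributive tensor_scale tensor_add.
Proof.
move=> a x y; rewrite -[x]treprK -[y]treprK -tpi_add -!tpi_scale -tpi_add.
exact/tpiP/teq_scaleDr.
Qed.

Fact tensor_scaleA a b x :
  tensor_scale a (tensor_scale b x) = tensor_scale (a * b) x.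
Proof. by rewrite -[x]treprK -!tpi_scale; apply/tpiP/teq_scaleA. Qed.

Fact tensor_add0 : left_id tensor_zero tensor_add.
Proof.
move=> x; transitivity (tensor_add (tensor_scale 0 x) (tensor_scale 1 x)).
  by rewrite tensor_scale0 tensor_scale1.
by rewrite -tensor_scaleDl add0r tensor_scale1.
Qed.

Fact tensor_addN : left_inverse tensor_zero (tensor_scale (-1)) tensor_add.
Proof.
by move=> x; rewrite -{2}[x]tensor_scale1 -tensor_scaleDl addNr tensor_scale0.
Qed.

HB.instance Definition _ := GRing.isZmodule.Build tensor
  tensor_addA tensor_addC tensor_add0 tensor_addN.

HB.instance Definition _ := GRing.Zmodule_isLmodule.Build k tensor
  tensor_scaleA tensor_scale1 tensor_scaleDr tensor_scaleDl.

Lemma tpiD s t : tpi (TAdd s t) = tpi s + tpi t.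
Proof. exact: tpi_add. Qed.

Lemma tpiZ a t : tpi (TScale a t) = a *: tpi t.
Proof. exact: tpi_scale. Qed.

Fact tens_bilinear :
  bilinear_for *:%R *:%R tens.
Proof.
split=> [w a v v'|v a w w'].
  transitivity (tens (a *: v) w + tens v' w).
    by rewrite /tens -tpiD; apply/tpiP/teq_pureDl.
  by congr (_ + _); apply: etrans (tpiZ _ _); apply/tpiP/teq_pureZl.
transitivity (tens v (a *: w) + tens v w').
  by rewrite /tens -tpiD; apply/tpiP/teq_pureDr.
by congr (_ + _); apply: etrans (tpiZ _ _); apply/tpiP/teq_pureZr.
Qed.

HB.instance Definition _ := bilinear_isBilinear.Build k V W tensor *:%R *:%R
  tens tens_bilinear.

Lemma tensor_ind (P : tensor -> Prop) :
    (forall v w, P (tens v w)) -> (forall x y, P x -> P y -> P (x + y)) ->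
  forall x, P x.
Proof.
move=> Ppure Padd x; rewrite -[x]treprK; set t := trepr x.
suff: forall a, P (a *: tpi t) by move/(_ 1); rewrite scale1r.
elim: t => {x} [v w|s IHs t IHt|b t IHt] a.
- by have := Ppure (a *: v) w; rewrite linearZl_LR.
- by rewrite tpiD scalerDr; apply: Padd.
- by rewrite tpiZ scalerA.
Qed.

End TensorDef.

Notation "v ⊗ w" := (tens v w) : ring_scope.

Section TensorLift.
Variables (k : fieldType) (V W X : lmodType k) (f : {bilinear V -> W -> X}).

Fixpoint teval (t : tterm V W) : X :=
  match t with
  | TPure v w => f v w
  | TAdd s t => teval s + teval t
  | TScale a t => a *: teval t
  end.

Lemma teval_eq s t : teq s t -> teval s = teval t.
Proof.
elim=> //= {s t}.
- by move=> s t u _ -> _ ->.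
- by move=> s s' t t' _ -> _ ->.
- by move=> a t t' _ ->.
- by move=> s t u; rewrite addrA.
- by move=> s t; rewrite addrC.
- by move=> a b t; rewrite scalerA.
- by move=> t; rewrite scale1r.
- by move=> t; rewrite scale0r linear0r.
- by move=> a s t; rewrite scalerDr.
- by move=> a b t; rewrite scalerDl.
- by move=> v v' w; rewrite linearDl.
- by move=> v w w'; rewrite linearDr.
- by move=> a v w; rewrite linearZl_LR.
- by move=> a v w; rewrite linearZr_LR.
Qed.

Definition tlift (x : tensor V W) : X := teval (trepr x).

Lemma tlift_pi t : tlift (tpi t) = teval t.
Proof. exact/teval_eq/trepr_pi. Qed.

Lemma tliftE v w : tlift (v ⊗ w) = f v w.
Proof. exact: tlift_pi. Qed.

Fact tlift_linear : linear tlift.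
Proof.
move=> a x y; rewrite -[x]treprK -[y]treprK.
rewrite -tpiZ -tpiD.
by rewrite !tlift_pi.
Qed.

HB.instance Definition _ :=
  GRing.isLinear.Build k (tensor V W) X *:%R tlift tlift_linear.

Lemma tliftD : {morph tlift : x y / x + y}.
Proof. exact: linearD. Qed.

End TensorLift.

Lemma tensor_eq (k : fieldType) (V W X : lmodType k) (f g : {linear tensor V W -> X}) :
  (forall v w, f (v ⊗ w) = g (v ⊗ w)) -> f =1 g.
Proof.
by move=> fg; elim/tensor_ind=> // x y IHx IHy; rewrite !linearD IHx IHy.
Qed.

Section TensorMap.
Variables (k : fieldType) (V W V' W' : lmodType k).
Variables (f : {linear V -> V'}) (g : {linear W -> W'}).

Definition tmap_fun (v : V) (w : W) : tensor V' W' := f v ⊗ g w.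

Fact tmap_bilinear :
  bilinear_for *:%R *:%R tmap_fun.
Proof.
split=> [w a v v'|v a w w']; rewrite /tmap_fun.
  by rewrite linearP linearDl linearZl_LR.
by rewrite linearP linearDr linearZr_LR.
Qed.

HB.instance Definition _ := bilinear_isBilinear.Build k V W (tensor V' W') *:%R *:%R
  tmap_fun tmap_bilinear.

Definition tmap : tensor V W -> tensor V' W' := tlift tmap_fun.

HB.instance Definition _ := GRing.Linear.on tmap.

Lemma tmapE v w : tmap (v ⊗ w) = f v ⊗ g w.
Proof. exact: tliftE. Qed.

End TensorMap.

Section TensorAssoc.
Variables (k : fieldType) (U V W : lmodType k).

Definition tassoc_fun2 (w : W) (u : U) (v : V) : tensor U (tensor V W) := u ⊗ (v ⊗ w).

Fact tassoc_bilinear2 w :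
  bilinear_for *:%R *:%R (tassoc_fun2 w).
Proof.
split=> [v a u u'|u a v v']; rewrite /tassoc_fun2.
  by rewrite linearDl linearZl_LR.
by rewrite linearDl linearZl_LR linearDr linearZr_LR.
Qed.

HB.instance Definition _ w :=
  bilinear_isBilinear.Build k U V (tensor U (tensor V W)) *:%R *:%R
  (tassoc_fun2 w) (tassoc_bilinear2 w).

Definition tassoc_fun (x : tensor U V) (w : W) : tensor U (tensor V W) :=
  tlift (tassoc_fun2 w) x.

Fact tassoc_bilinear :
  bilinear_for *:%R *:%R tassoc_fun.
Proof.
split=> [w a x y|x a w w']; rewrite /tassoc_fun; first by rewrite linearP.
elim/tensor_ind: x => [u v|x y IHx IHy].
  by rewrite !tliftE /= /tassoc_fun2 !(linearDr, linearZr_LR).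
by rewrite !tliftD IHx IHy /= scalerDr addrACA.
Qed.

HB.instance Definition _ :=
  bilinear_isBilinear.Build k (tensor U V) W (tensor U (tensor V W)) *:%R *:%R
  tassoc_fun tassoc_bilinear.

Definition tassoc : tensor (tensor U V) W -> tensor U (tensor V W) := tlift tassoc_fun.

HB.instance Definition _ := GRing.Linear.on tassoc.

Lemma tassocE u v w : tassoc ((u ⊗ v) ⊗ w) = u ⊗ (v ⊗ w).
Proof. by rewrite /tassoc tliftE /= /tassoc_fun tliftE. Qed.

End TensorAssoc.

Section TensorSwap.
Variables (k : fieldType) (A B C D : lmodType k).
Local Notation T := (tensor (tensor A C) (tensor B D)).

Definition tswap_fun4 (a : A) (b : B) (c : C) (d : D) : T := (a ⊗ c) ⊗ (b ⊗ d).

Fact tswap_bilinear4 a b :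
  bilinear_for *:%R *:%R (tswap_fun4 a b).
Proof.
split=> [d e c c'|c e d d']; rewrite /tswap_fun4.
  by rewrite linearDr linearZr_LR linearDl linearZl_LR.
by rewrite linearDr linearZr_LR linearDr linearZr_LR.
Qed.

HB.instance Definition _ a b := bilinear_isBilinear.Build k C D T *:%R *:%R
  (tswap_fun4 a b) (tswap_bilinear4 a b).

Definition tswap_fun2 (y : tensor C D) (a : A) (b : B) : T := tlift (tswap_fun4 a b) y.

Fact tswap_bilinear2 y :
  bilinear_for *:%R *:%R (tswap_fun2 y).
Proof.
split=> [b e a a'|a e b b']; rewrite /tswap_fun2.
  elim/tensor_ind: y => [c d|x y IHx IHy].
    by rewrite !tliftE /= /tswap_fun4 !(linearDl, linearZl_LR).
  by rewrite !tliftD IHx IHy /= scalerDr addrACA.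
elim/tensor_ind: y => [c d|x y IHx IHy].
  by rewrite !tliftE /= /tswap_fun4 linearDl linearZl_LR linearDr linearZr_LR.
by rewrite !tliftD IHx IHy /= scalerDr addrACA.
Qed.

HB.instance Definition _ y := bilinear_isBilinear.Build k A B T *:%R *:%R
  (tswap_fun2 y) (tswap_bilinear2 y).

Definition tswap_fun (x : tensor A B) (y : tensor C D) : T := tlift (tswap_fun2 y) x.

Fact tswap_bilinear :
  bilinear_for *:%R *:%R tswap_fun.
Proof.
split=> [y e x x'|x e y y']; rewrite /tswap_fun; first by rewrite linearP.
elim/tensor_ind: x => [a b|x x' IHx IHx'].
  by rewrite !tliftE /= /tswap_fun2 linearP.
by rewrite !tliftD IHx IHx' /= scalerDr addrACA.
Qed.

HB.instance Definition _ :=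
  bilinear_isBilinear.Build k (tensor A B) (tensor C D) T *:%R *:%R
  tswap_fun tswap_bilinear.

Definition tswap : tensor (tensor A B) (tensor C D) -> tensor (tensor A C) (tensor B D) := tlift tswap_fun.

HB.instance Definition _ := GRing.Linear.on tswap.

Lemma tswapE a b c d : tswap ((a ⊗ b) ⊗ (c ⊗ d)) = (a ⊗ c) ⊗ (b ⊗ d).
Proof. by rewrite /tswap tliftE /= /tswap_fun tliftE /= /tswap_fun2 tliftE. Qed.

End TensorSwap.

(* Componentwise product of two operations:                                   *)
(* [top2 f g ((a ⊗ b) ⊗ (a' ⊗ b')) = f (a ⊗ a') ⊗ g (b ⊗ b')].                *)
Section TensorOp.
Variables (k : fieldType) (A B : lmodType k).
Variables (f : {linear tensor A A -> A}) (g : {linear tensor B B -> B}).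

Definition top2 : tensor (tensor A B) (tensor A B) -> tensor A B :=
  tmap f g \o @tswap k A B A B.

HB.instance Definition _ := GRing.Linear.on top2.

Lemma top2E a b a' b' :
  top2 ((a ⊗ b) ⊗ (a' ⊗ b')) = f (a ⊗ a') ⊗ g (b ⊗ b').
Proof. by rewrite /top2 /= tswapE tmapE. Qed.

End TensorOp.

(** * Algebras, Hopf algebras and Poisson Hopf algebras *)

(* The product of the algebra [tensor A B] is [top2 (alg_mul A) (alg_mul B)]. *)
Section AlgMul.
Variables (k : fieldType) (A : algType k).

Definition alg_mul_fun (a b : A) : A := a * b.

Fact alg_mul_bilinear : bilinear_for *:%R *:%R alg_mul_fun.
Proof.
split=> [b c a a'|a c b b']; rewrite /alg_mul_fun.
  by rewrite mulrDl -scalerAl.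
by rewrite mulrDr -scalerAr.
Qed.

HB.instance Definition _ := bilinear_isBilinear.Build k A A A *:%R *:%R
  alg_mul_fun alg_mul_bilinear.

Definition alg_mul : tensor A A -> A := tlift alg_mul_fun.

HB.instance Definition _ := GRing.Linear.on alg_mul.

Lemma alg_mulE a b : alg_mul (a ⊗ b) = a * b.
Proof. exact: tliftE. Qed.

End AlgMul.

Arguments alg_mul {k} A.

HB.mixin Record Algebra_isHopf (k : fieldType) H of GRing.Algebra k H := {
  comul : {linear H -> tensor H H};
  counit : {linear H -> k^o};
  antipode : {linear H -> H};
  comulA : forall a : H,
    tassoc (tmap comul idfun (comul a)) = tmap idfun comul (comul a);
  counitl : forall a : H, tmap counit idfun (comul a) = (1 : k^o) ⊗ a;
  counitr : forall a : H, tmap idfun counit (comul a) = a ⊗ (1 : k^o);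
  comul1 : comul (1 : H) = 1 ⊗ 1;
  comulM : forall a b : H,
    comul (a * b) = top2 (alg_mul H) (alg_mul H) (comul a ⊗ comul b);
  counit1 : counit (1 : H) = 1;
  counitM : forall a b : H, counit (a * b) = counit a * counit b;
  antipodel : forall a : H,
    alg_mul H (tmap antipode idfun (comul a)) = (counit a : k) *: 1;
  antipoder : forall a : H,
    alg_mul H (tmap idfun antipode (comul a)) = (counit a : k) *: 1
}.

#[short(type="hopfAlgType")]
HB.structure Definition HopfAlgebra (k : fieldType) :=
  {H of GRing.Algebra k H & Algebra_isHopf k H}.

Definition lie_law (k : fieldType) (L : lmodType k) (b : L -> L -> L) : Prop :=
  (forall x, b x x = 0) /\
  (forall x y z, b x (b y z) + b y (b z x) + b z (b x y) = 0).

HB.mixin Record Lmodule_isLie (k : fieldType) L of GRing.Lmodule k L := {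
  lie : {bilinear L -> L -> L};
  lieP : lie_law lie
}.

#[short(type="lieAlgType")]
HB.structure Definition LieAlgebra (k : fieldType) :=
  {L of GRing.Lmodule k L & Lmodule_isLie k L}.

Definition lie_abelian (k : fieldType) (g : lieAlgType k) : Prop :=
  forall x y : g, lie x y = 0.

Record is_poisson (k : fieldType) (A : algType k)
    (br : {linear tensor A A -> A}) : Prop := IsPoisson {
  poisson_lie : lie_law (fun a b => br (a ⊗ b));
  poisson_leibniz : forall a b c,
    br ((a * b) ⊗ c) = a * br (b ⊗ c) + br (a ⊗ c) * b
}.

Record is_poisson_hopf (k : fieldType) (H : hopfAlgType k)
    (br : {linear tensor H H -> H}) : Prop := IsPoissonHopf {
  poisson_hopf_poisson : is_poisson br;
  poisson_hopf_comul : forall a b : H,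
    comul (br (a ⊗ b)) = top2 br (alg_mul H) (comul a ⊗ comul b)
                       + top2 (alg_mul H) br (comul a ⊗ comul b)
}.

(** * Universal enveloping algebras *)

(* [uea g] is the unital associative algebra generated by the symbols         *)
(* [UGen x], [x : g], subject to linearity in [x] and                         *)
(* [UGen (lie x y) = UGen x * UGen y - UGen y * UGen x]: the quotient of the  *)
(* tensor algebra of [g] by the usual ideal.                                  *)
Section UeaTerms.
Variables (k : fieldType) (g : lieAlgType k).

Inductive uterm : Type :=
| UGen of g
| UOne
| UAdd of uterm & uterm
| UMul of uterm & uterm
| UScale of k & uterm.

Inductive ueq : uterm -> uterm -> Prop :=
| ueq_refl t : ueq t t
| ueq_sym s t : ueq s t -> ueq t s
| ueq_trans s t u : ueq s t -> ueq t u -> ueq s u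
| ueq_add s s' t t' : ueq s s' -> ueq t t' -> ueq (UAdd s t) (UAdd s' t')
| ueq_mul s s' t t' : ueq s s' -> ueq t t' -> ueq (UMul s t) (UMul s' t')
| ueq_scale a t t' : ueq t t' -> ueq (UScale a t) (UScale a t')
| ueq_addA s t u : ueq (UAdd s (UAdd t u)) (UAdd (UAdd s t) u)
| ueq_addC s t : ueq (UAdd s t) (UAdd t s)
| ueq_scaleA a b t : ueq (UScale a (UScale b t)) (UScale (a * b) t)
| ueq_scale1 t : ueq (UScale 1 t) t
| ueq_scale0 t : ueq (UScale 0 t) (UScale 0 UOne)
| ueq_scaleDr a s t : ueq (UScale a (UAdd s t)) (UAdd (UScale a s) (UScale a t))
| ueq_scaleDl a b t : ueq (UScale (a + b) t) (UAdd (UScale a t) (UScale b t))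
| ueq_mulA s t u : ueq (UMul s (UMul t u)) (UMul (UMul s t) u)
| ueq_mul1l t : ueq (UMul UOne t) t
| ueq_mul1r t : ueq (UMul t UOne) t
| ueq_mulDl s t u : ueq (UMul (UAdd s t) u) (UAdd (UMul s u) (UMul t u))
| ueq_mulDr s t u : ueq (UMul s (UAdd t u)) (UAdd (UMul s t) (UMul s u))
| ueq_scaleAl a s t : ueq (UScale a (UMul s t)) (UMul (UScale a s) t)
| ueq_scaleAr a s t : ueq (UScale a (UMul s t)) (UMul s (UScale a t))
| ueq_genD x y : ueq (UGen (x + y)) (UAdd (UGen x) (UGen y))
| ueq_genZ a x : ueq (UGen (a *: x)) (UScale a (UGen x))
| ueq_lie x y : ueq (UGen (lie x y))
    (UAdd (UMul (UGen x) (UGen y)) (UScale (-1) (UMul (UGen y) (UGen x)))).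

HB.instance Definition _ := gen_eqMixin uterm.
HB.instance Definition _ := gen_choiceMixin uterm.

Definition ueqb (s t : uterm) : bool := `[< ueq s t >].

Fact ueqb_refl : reflexive ueqb.
Proof. by move=> t; apply/asboolP/ueq_refl. Qed.

Fact ueqb_sym : symmetric ueqb.
Proof. by move=> s t; apply/asboolP/asboolP=> /ueq_sym. Qed.

Fact ueqb_trans : transitive ueqb.
Proof.
by move=> t s u /asboolP st /asboolP tu; apply/asboolP/(ueq_trans st tu).
Qed.

Definition ueq_equiv := EquivRel ueqb ueqb_refl ueqb_sym ueqb_trans.

End UeaTerms.

(* Evaluation in an associative unital algebra [(X, m, e)] that is not        *)
(* required to be an instance of [algType], so that [X] can be a tensor       *)
(* product or an opposite algebra.                                            *)
Section UeaEval.
Variables (k : fieldType) (g : lieAlgType k) (X : lmodType k).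
Variables (m : {linear tensor X X -> X}) (e : X) (phi : {linear g -> X}).
Hypotheses (mA : forall x y z, m (x ⊗ m (y ⊗ z)) = m (m (x ⊗ y) ⊗ z))
  (m1l : forall x, m (e ⊗ x) = x) (m1r : forall x, m (x ⊗ e) = x)
  (phi_lie : forall x y,
     phi (lie x y) = m (phi x ⊗ phi y) - m (phi y ⊗ phi x)).

Fixpoint ueval (t : uterm g) : X :=
  match t with
  | UGen x => phi x
  | UOne => e
  | UAdd s t => ueval s + ueval t
  | UMul s t => m (ueval s ⊗ ueval t)
  | UScale a t => a *: ueval t
  end.

Lemma ueval_eq s t : ueq s t -> ueval s = ueval t.
Proof.
elim=> //= {s t}.
- by move=> s t u _ -> _ ->.
- by move=> s s' t t' _ -> _ ->.
- by move=> s s' t t' _ -> _ ->.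
- by move=> a t t' _ ->.
- by move=> s t u; rewrite addrA.
- by move=> s t; rewrite addrC.
- by move=> a b t; rewrite scalerA.
- by move=> t; rewrite scale1r.
- by move=> t; rewrite !scale0r.
- by move=> a s t; rewrite scalerDr.
- by move=> a b t; rewrite scalerDl.
- by move=> s t u; rewrite linearDl linearD.
- by move=> s t u; rewrite linearDr linearD.
- by move=> a s t; rewrite linearZl_LR linearZ.
- by move=> a s t; rewrite linearZr_LR linearZ.
- by move=> x y; rewrite linearD.
- by move=> a x; rewrite linearZ.
- by move=> x y; rewrite phi_lie scaleN1r.
Qed.

End UeaEval.

Section UeaDef.
Variables (k : fieldType) (g : lieAlgType k).

Definition uea : Type := {eq_quot @ueq_equiv k g}.

HB.instance Definition _ := Choice.copy uea {eq_quot @ueq_equiv k g}.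

Definition upi (t : uterm g) : uea := \pi_({eq_quot @ueq_equiv k g}) t.
Definition urepr (x : uea) : uterm g := repr (x : {eq_quot @ueq_equiv k g}).

Lemma ureprK x : upi (urepr x) = x.
Proof. exact: reprK. Qed.

Lemma upiP s t : upi s = upi t <-> ueq s t.
Proof.
have P := @eqmodP _ (@ueq_equiv k g) s t.
by split=> [/P /asboolP|/asboolP /P].
Qed.

Lemma urepr_pi t : ueq (urepr (upi t)) t.
Proof. by apply/upiP; rewrite ureprK. Qed.

Definition ugen (x : g) : uea := upi (UGen x).
Definition uea_one : uea := upi (UOne g).
Definition uea_zero : uea := upi (UScale 0 (UOne g)).
Definition uea_add (x y : uea) : uea := upi (UAdd (urepr x) (urepr y)).
Definition uea_mul (x y : uea) : uea := upi (UMul (urepr x) (urepr y)).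
Definition uea_scale (a : k) (x : uea) : uea := upi (UScale a (urepr x)).

Lemma upi_add s t : upi (UAdd s t) = uea_add (upi s) (upi t).
Proof. by apply/upiP/ueq_add; apply/ueq_sym/urepr_pi. Qed.

Lemma upi_mul s t : upi (UMul s t) = uea_mul (upi s) (upi t).
Proof. by apply/upiP/ueq_mul; apply/ueq_sym/urepr_pi. Qed.

Lemma upi_scale a t : upi (UScale a t) = uea_scale a (upi t).
Proof. by apply/upiP/ueq_scale/ueq_sym/urepr_pi. Qed.

Fact uea_addA : associative uea_add.
Proof.
move=> x y z; rewrite -[x]ureprK -[y]ureprK -[z]ureprK -!upi_add.
exact/upiP/ueq_addA.
Qed.

Fact uea_addC : commutative uea_add.
Proof.
by move=> x y; rewrite -[x]ureprK -[y]ureprK -!upi_add; apply/upiP/ueq_addC.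
Qed.

Fact uea_scale1 : left_id 1 uea_scale.
Proof. by move=> x; rewrite -[x]ureprK -upi_scale; apply/upiP/ueq_scale1. Qed.

Fact uea_scale0 x : uea_scale 0 x = uea_zero.
Proof. by rewrite -[x]ureprK -upi_scale; apply/upiP/ueq_scale0. Qed.

Fact uea_scaleDl x : {morph uea_scale^~ x : a b / a + b >-> uea_add a b}.
Proof.
by move=> a b; rewrite -[x]ureprK -!upi_scale -upi_add; apply/upiP/ueq_scaleDl.
Qed.

Fact uea_scaleDr : right_distributive uea_scale uea_add.
Proof.
move=> a x y; rewrite -[x]ureprK -[y]ureprK -upi_add -!upi_scale -upi_add.
exact/upiP/ueq_scaleDr.
Qed.

Fact uea_scaleA a b x : uea_scale a (uea_scale b x) = uea_scale (a * b) x.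
Proof. by rewrite -[x]ureprK -!upi_scale; apply/upiP/ueq_scaleA. Qed.

Fact uea_add0 : left_id uea_zero uea_add.
Proof.
move=> x; transitivity (uea_add (uea_scale 0 x) (uea_scale 1 x)).
  by rewrite uea_scale0 uea_scale1.
by rewrite -uea_scaleDl add0r uea_scale1.
Qed.

Fact uea_addN : left_inverse uea_zero (uea_scale (-1)) uea_add.
Proof.
by move=> x; rewrite -{2}[x]uea_scale1 -uea_scaleDl addNr uea_scale0.
Qed.

HB.instance Definition _ := GRing.isZmodule.Build uea
  uea_addA uea_addC uea_add0 uea_addN.

Fact uea_mulA : associative uea_mul.
Proof.
move=> x y z; rewrite -[x]ureprK -[y]ureprK -[z]ureprK -!upi_mul.
exact/upiP/ueq_mulA.
Qed.

Fact uea_mul1l : left_id uea_one uea_mul.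
Proof. by move=> x; rewrite -[x]ureprK -upi_mul; apply/upiP/ueq_mul1l. Qed.

Fact uea_mul1r : right_id uea_one uea_mul.
Proof. by move=> x; rewrite -[x]ureprK -upi_mul; apply/upiP/ueq_mul1r. Qed.

Fact uea_mulDl : left_distributive uea_mul uea_add.
Proof.
move=> x y z; rewrite -[x]ureprK -[y]ureprK -[z]ureprK.
by rewrite -upi_add -!upi_mul -upi_add; apply/upiP/ueq_mulDl.
Qed.

Fact uea_mulDr : right_distributive uea_mul uea_add.
Proof.
move=> x y z; rewrite -[x]ureprK -[y]ureprK -[z]ureprK.
by rewrite -upi_add -!upi_mul -upi_add; apply/upiP/ueq_mulDr.
Qed.

Fact uea_oner_neq0 : uea_one != uea_zero.
Proof.
apply/eqP=> /upiP e10; pose phi : {linear g -> k^o} := \0%R.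
suff: ueval (alg_mul k^o) 1 phi (UOne g) = ueval (alg_mul k^o) 1 phi
    (UScale 0 (UOne g)) by rewrite /= scale0r; apply/eqP; exact: (oner_neq0 k).
apply: ueval_eq e10.
- by move=> x y z; rewrite /= !alg_mulE mulrA.
- by move=> x; rewrite /= alg_mulE mul1r.
- by move=> x; rewrite /= alg_mulE mulr1.
- by move=> x y; rewrite /= !alg_mulE mul0r subrr.
Qed.

HB.instance Definition _ := GRing.Zmodule_isNzRing.Build uea
  uea_mulA uea_mul1l uea_mul1r uea_mulDl uea_mulDr uea_oner_neq0.

HB.instance Definition _ := GRing.Zmodule_isLmodule.Build k uea
  uea_scaleA uea_scale1 uea_scaleDr uea_scaleDl.

Fact uea_scaleAl (a : k) (x y : uea) : a *: (x * y) = a *: x * y.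
Proof.
rewrite -[x]ureprK -[y]ureprK.
rewrite -[LHS]/(uea_scale _ (uea_mul _ _)) -[RHS]/(uea_mul (uea_scale _ _) _).
by rewrite -upi_mul -!upi_scale -upi_mul; apply/upiP/ueq_scaleAl.
Qed.

HB.instance Definition _ := GRing.Lmodule_isLalgebra.Build k uea uea_scaleAl.

Fact uea_scaleAr (a : k) (x y : uea) : a *: (x * y) = x * (a *: y).
Proof.
rewrite -[x]ureprK -[y]ureprK.
rewrite -[LHS]/(uea_scale _ (uea_mul _ _)) -[RHS]/(uea_mul _ (uea_scale _ _)).
by rewrite -upi_mul -!upi_scale -upi_mul; apply/upiP/ueq_scaleAr.
Qed.

HB.instance Definition _ := GRing.Lalgebra_isAlgebra.Build k uea uea_scaleAr.

Lemma upi1 : upi (UOne g) = 1.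
Proof. by []. Qed.

Lemma upiD s t : upi (UAdd s t) = upi s + upi t.
Proof. exact: upi_add. Qed.

Lemma upiM s t : upi (UMul s t) = upi s * upi t.
Proof. exact: upi_mul. Qed.

Lemma upiZ a t : upi (UScale a t) = a *: upi t.
Proof. exact: upi_scale. Qed.

Fact ugen_linear : linear ugen.
Proof.
move=> a x y; transitivity (ugen (a *: x) + ugen y).
  by rewrite /ugen -upiD; apply/upiP/ueq_genD.
by congr (_ + _); apply: etrans (upiZ _ _); apply/upiP/ueq_genZ.
Qed.

HB.instance Definition _ := GRing.isLinear.Build k g uea *:%R ugen ugen_linear.

Lemma ugen_lie x y : ugen (lie x y) = ugen x * ugen y - ugen y * ugen x.
Proof. by rewrite -scaleN1r /ugen -!upiM -upiZ -upiD; apply/upiP/ueq_lie. Qed.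

Lemma uea_ind (P : uea -> Prop) :
    (forall x, P (ugen x)) -> P 1 -> (forall x y, P x -> P y -> P (x + y)) ->
    (forall x y, P x -> P y -> P (x * y)) -> (forall a x, P x -> P (a *: x)) ->
  forall x, P x.
Proof.
move=> Pg P1 PD PM PZ x; rewrite -[x]ureprK.
elim: (urepr x) => {x} [x||s Ps t Pt|s Ps t Pt|a t Pt].
- exact: Pg.
- exact: P1.
- by rewrite upiD; apply: PD.
- by rewrite upiM; apply: PM.
- by rewrite upiZ; apply: PZ.
Qed.

End UeaDef.

Section UeaLift.
Variables (k : fieldType) (g : lieAlgType k) (X : lmodType k).
Variables (m : {linear tensor X X -> X}) (e : X) (phi : {linear g -> X}).

Definition is_uea_target : Prop :=
  [/\ forall x y z, m (x ⊗ m (y ⊗ z)) = m (m (x ⊗ y) ⊗ z),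
      forall x, m (e ⊗ x) = x, forall x, m (x ⊗ e) = x
    & forall x y, phi (lie x y) = m (phi x ⊗ phi y) - m (phi y ⊗ phi x)].

Definition ulift of is_uea_target := fun x : uea g => ueval m e phi (urepr x).

Variable mP : is_uea_target.

Lemma ulift_pi t : ulift mP (upi t) = ueval m e phi t.
Proof. by case: mP => ? ? ? ?; apply/ueval_eq/urepr_pi. Qed.

Fact ulift_linear : linear (ulift mP).
Proof.
move=> a x y; rewrite -[x]ureprK -[y]ureprK.
by rewrite -upiZ -upiD !ulift_pi.
Qed.

HB.instance Definition _ :=
  GRing.isLinear.Build k (uea g) X *:%R (ulift mP) ulift_linear.

Lemma ulift_gen x : ulift mP (ugen x) = phi x.
Proof. exact: ulift_pi. Qed.

Lemma ulift1 : ulift mP 1 = e.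
Proof. exact: ulift_pi. Qed.

Lemma uliftM x y : ulift mP (x * y) = m (ulift mP x ⊗ ulift mP y).
Proof. by rewrite -[x]ureprK -[y]ureprK -upiM !ulift_pi. Qed.

End UeaLift.

(* The standard Hopf algebra structure: the elements of [g] are primitive.    *)
Section TensorOpTheory.
Variable k : fieldType.

Lemma tensor_ind2 (A B : lmodType k) (P : tensor A B -> tensor A B -> Prop) :
    (forall a b a' b', P (a ⊗ b) (a' ⊗ b')) ->
    (forall s s' t, P s t -> P s' t -> P (s + s') t) ->
    (forall s t t', P s t -> P s t' -> P s (t + t')) ->
  forall s t, P s t.
Proof.
move=> Pp Pl Pr; elim/tensor_ind=> [a b|s s' IH IH'] t; last exact: Pl.
by elim/tensor_ind: t => [a' b'|t t' IH IH']; [exact: Pp | exact: Pr].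
Qed.

Lemma top2A (A B : lmodType k) (f : {linear tensor A A -> A})
    (g : {linear tensor B B -> B}) :
    (forall x y z, f (x ⊗ f (y ⊗ z)) = f (f (x ⊗ y) ⊗ z)) ->
    (forall x y z, g (x ⊗ g (y ⊗ z)) = g (g (x ⊗ y) ⊗ z)) ->
  forall x y z, top2 f g (x ⊗ top2 f g (y ⊗ z)) = top2 f g (top2 f g (x ⊗ y) ⊗ z).
Proof.
move=> fA gA x y z; elim/tensor_ind: x => [a b|x x' IH IH']; last first.
  by rewrite !(linearDl, linearD) /= IH IH'.
move: y z; apply: tensor_ind2=> [a1 b1 a2 b2|s s' t IH IH'|s t t' IH IH'].
- by rewrite !top2E fA gA.
- by rewrite !(linearDl, linearDr, linearD) /= IH IH'.
- by rewrite !(linearDl, linearDr, linearD) /= IH IH'.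
Qed.

Lemma top2_1l (A B : lmodType k) (f : {linear tensor A A -> A})
    (g : {linear tensor B B -> B}) e e' :
  (forall x, f (e ⊗ x) = x) -> (forall x, g (e' ⊗ x) = x) ->
  forall x, top2 f g ((e ⊗ e') ⊗ x) = x.
Proof.
move=> f1 g1; elim/tensor_ind=> [a b|x y IH IH']; first by rewrite top2E f1 g1.
by rewrite linearDr linearD /= IH IH'.
Qed.

Lemma top2_1r (A B : lmodType k) (f : {linear tensor A A -> A})
    (g : {linear tensor B B -> B}) e e' :
  (forall x, f (x ⊗ e) = x) -> (forall x, g (x ⊗ e') = x) ->
  forall x, top2 f g (x ⊗ (e ⊗ e')) = x.
Proof.
move=> f1 g1; elim/tensor_ind=> [a b|x y IH IH']; first by rewrite top2E f1 g1.
by rewrite linearDl linearD /= IH IH'.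
Qed.

Lemma tmap_top2 (A B A' B' : lmodType k) (f : {linear tensor A A -> A})
    (g : {linear tensor B B -> B}) (f' : {linear tensor A' A' -> A'})
    (g' : {linear tensor B' B' -> B'}) (p : {linear A -> A'})
    (q : {linear B -> B'}) :
    (forall x y, p (f (x ⊗ y)) = f' (p x ⊗ p y)) ->
    (forall x y, q (g (x ⊗ y)) = g' (q x ⊗ q y)) ->
  forall s t, tmap p q (top2 f g (s ⊗ t)) = top2 f' g' (tmap p q s ⊗ tmap p q t).
Proof.
move=> pM qM; apply: tensor_ind2=> [a b a1 b1|s s' t IH IH'|s t t' IH IH'].
- by rewrite top2E !tmapE top2E pM qM.
- by rewrite !(linearDl, linearD) /= IH IH'.
- by rewrite !(linearDr, linearD) /= IH IH'.
Qed.

Lemma tassoc_top2 (A B C : lmodType k) (f : {linear tensor A A -> A})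
    (g : {linear tensor B B -> B}) (h : {linear tensor C C -> C}) s t :
  tassoc (top2 (top2 f g) h (s ⊗ t)) = top2 f (top2 g h) (tassoc s ⊗ tassoc t).
Proof.
move: s t; apply: tensor_ind2=> [x c x1 c1|s s' t IH IH'|s t t' IH IH'].
- move: x x1; apply: tensor_ind2=> [a b a1 b1|s s' t IH IH'|s t t' IH IH'].
  + by rewrite top2E /= top2E !tassocE top2E /= top2E.
  + by rewrite !(linearDl, linearD) /= IH IH'.
  + by rewrite !(linearDl, linearDr, linearD) /= IH IH'.
- by rewrite !(linearDl, linearD) /= IH IH'.
- by rewrite !(linearDr, linearD) /= IH IH'.
Qed.

End TensorOpTheory.

Section UeaHopf.
Variables (k : fieldType) (g : lieAlgType k).
Local Notation U := (uea g).
Local Notation mU := (alg_mul U).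

Lemma ulift_eq (X : lmodType k) (m : {linear tensor X X -> X})
    (F G : {linear U -> X}) :
    (forall x, F (ugen x) = G (ugen x)) -> F 1 = G 1 ->
    (forall x y, F (x * y) = m (F x ⊗ F y)) ->
    (forall x y, G (x * y) = m (G x ⊗ G y)) ->
  F =1 G.
Proof.
move=> FGg FG1 FM GM; elim/uea_ind=> //.
- by move=> x y IHx IHy; rewrite !linearD IHx IHy.
- by move=> x y IHx IHy; rewrite FM GM IHx IHy.
- by move=> a x IHx; rewrite !linearZ IHx.
Qed.

Definition uea_prim (x : g) : tensor U U := ugen x ⊗ 1 + 1 ⊗ ugen x.

Fact uea_prim_linear : linear uea_prim.
Proof.
move=> a x y; rewrite /uea_prim linearP linearDl linearDr linearZl_LR linearZr_LR.
by rewrite scalerDr addrACA.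
Qed.

HB.instance Definition _ :=
  GRing.isLinear.Build k g (tensor U U) *:%R uea_prim uea_prim_linear.

Fact uea_comulP : is_uea_target (top2 mU mU) (1 ⊗ 1) uea_prim.
Proof.
have mA x y z : mU (x ⊗ mU (y ⊗ z)) = mU (mU (x ⊗ y) ⊗ z).
  by rewrite !alg_mulE mulrA.
have m1l x : mU (1 ⊗ x) = x by rewrite alg_mulE mul1r.
have m1r x : mU (x ⊗ 1) = x by rewrite alg_mulE mulr1.
split; first exact: top2A; [exact: top2_1l | exact: top2_1r |].
have mE x y : top2 mU mU (uea_prim x ⊗ uea_prim y) =
    (ugen x * ugen y) ⊗ 1 + 1 ⊗ (ugen x * ugen y)
    + (ugen x ⊗ ugen y + ugen y ⊗ ugen x).
  rewrite /uea_prim !(linearDl, linearDr, linearD) /= !top2E /= !m1l !m1r !alg_mulE.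
  by rewrite [X in _ + X]addrC addrACA [X in _ + X]addrC.
move=> x y; rewrite /= !mE [X in _ + _ - (_ + X)]addrC opprD addrACA subrr addr0.
by rewrite /uea_prim ugen_lie linearBl linearBr opprD addrACA.
Qed.

Definition uea_comul : U -> tensor U U := ulift uea_comulP.
HB.instance Definition _ := GRing.Linear.on uea_comul.

Fact uea_counitP : is_uea_target (alg_mul k^o) 1 (\0%R : {linear g -> k^o}).
Proof.
split=> [x y z|x|x|x y]; rewrite /= !alg_mulE ?mulrA ?mul1r ?mulr1 //.
by rewrite mul0r subrr.
Qed.

Definition uea_counit : U -> k^o := ulift uea_counitP.
HB.instance Definition _ := GRing.Linear.on uea_counit.

Definition uea_opmul_fun (a b : U) : U := b * a.

Fact uea_opmul_bilinear : bilinear_for *:%R *:%R uea_opmul_fun.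
Proof.
split=> [b c a a'|a c b b']; rewrite /uea_opmul_fun.
  by rewrite mulrDr -scalerAr.
by rewrite mulrDl -scalerAl.
Qed.

HB.instance Definition _ := bilinear_isBilinear.Build k U U U *:%R *:%R
  uea_opmul_fun uea_opmul_bilinear.

Definition uea_oppgen (x : g) : U := - ugen x.

Fact uea_oppgen_linear : linear uea_oppgen.
Proof. by move=> a x y; rewrite /uea_oppgen linearP opprD scalerN. Qed.

HB.instance Definition _ :=
  GRing.isLinear.Build k g U *:%R uea_oppgen uea_oppgen_linear.

Fact uea_antipodeP : is_uea_target (tlift uea_opmul_fun) 1 uea_oppgen.
Proof.
split=> [x y z|x|x|x y]; rewrite /= !tliftE /= /uea_opmul_fun ?tliftE /=.
- by rewrite mulrA.
- by rewrite mulr1.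
- by rewrite mul1r.
- by rewrite /uea_oppgen ugen_lie !mulrNN opprB.
Qed.

Definition uea_antipode : U -> U := ulift uea_antipodeP.
HB.instance Definition _ := GRing.Linear.on uea_antipode.

Lemma uea_comul_gen x : uea_comul (ugen x) = ugen x ⊗ 1 + 1 ⊗ ugen x.
Proof. exact: ulift_gen. Qed.

Lemma uea_counit_gen x : uea_counit (ugen x) = 0.
Proof. exact: ulift_gen. Qed.

Lemma uea_antipode_gen x : uea_antipode (ugen x) = - ugen x.
Proof. exact: ulift_gen. Qed.

Fact uea_comul1 : uea_comul 1 = 1 ⊗ 1.
Proof. exact: ulift1. Qed.

Fact uea_comulM a b :
  uea_comul (a * b) = top2 mU mU (uea_comul a ⊗ uea_comul b).
Proof. exact: uliftM. Qed.

Fact uea_counit1 : uea_counit 1 = 1.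
Proof. exact: ulift1. Qed.

Fact uea_counitM a b : uea_counit (a * b) = uea_counit a * uea_counit b.
Proof. by rewrite /uea_counit uliftM /= alg_mulE. Qed.

Fact uea_antipode1 : uea_antipode 1 = 1.
Proof. exact: ulift1. Qed.

Fact uea_antipodeM a b :
  uea_antipode (a * b) = uea_antipode b * uea_antipode a.
Proof. by rewrite /uea_antipode uliftM /= tliftE. Qed.

Fact uea_comulA a :
  tassoc (tmap uea_comul idfun (uea_comul a)) =
  tmap idfun uea_comul (uea_comul a).
Proof.
pose F : {linear U -> tensor U (tensor U U)} :=
  @tassoc k U U U \o (tmap uea_comul idfun \o uea_comul).
pose G : {linear U -> tensor U (tensor U U)} := tmap idfun uea_comul \o uea_comul.
apply: (@ulift_eq _ (top2 mU (top2 mU mU)) F G) => [x||x y|x y] /=.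
- rewrite uea_comul_gen !linearD /= !tmapE /= uea_comul_gen uea_comul1.
  by rewrite linearDl linearDr linearD /= !tassocE addrA.
- by rewrite uea_comul1 !tmapE /= uea_comul1 tassocE.
- rewrite uea_comulM -(tassoc_top2 mU mU mU); congr tassoc.
  by apply: tmap_top2 => u v; rewrite /= alg_mulE ?uea_comulM.
- rewrite uea_comulM.
  by apply: tmap_top2 => u v; rewrite /= alg_mulE ?uea_comulM.
Qed.

Definition uea_tens1l (a : U) : tensor k^o U := (1 : k^o) ⊗ a.

Fact uea_tens1l_linear : linear uea_tens1l.
Proof. by move=> c a b; rewrite /uea_tens1l linearDr linearZr_LR. Qed.

HB.instance Definition _ :=
  GRing.isLinear.Build k U (tensor k^o U) *:%R uea_tens1l uea_tens1l_linear.

Definition uea_tens1r (a : U) : tensor U k^o := a ⊗ (1 : k^o).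

Fact uea_tens1r_linear : linear uea_tens1r.
Proof. by move=> c a b; rewrite /uea_tens1r linearDl linearZl_LR. Qed.

HB.instance Definition _ :=
  GRing.isLinear.Build k U (tensor U k^o) *:%R uea_tens1r uea_tens1r_linear.

Fact uea_counitl a : tmap uea_counit idfun (uea_comul a) = (1 : k^o) ⊗ a.
Proof.
pose F : {linear U -> tensor k^o U} := tmap uea_counit idfun \o uea_comul.
pose G : {linear U -> tensor k^o U} := uea_tens1l.
apply: (@ulift_eq _ (top2 (alg_mul k^o) mU) F G) => [x||x y|x y] /=.
- rewrite uea_comul_gen !linearD /= !tmapE /= uea_counit_gen uea_counit1.
  by rewrite linear0l add0r.
- by rewrite uea_comul1 !tmapE /= uea_counit1.
- rewrite uea_comulM.
  by apply: tmap_top2 => u v; rewrite /= !alg_mulE ?uea_counitM.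
- by rewrite /uea_tens1l /uea_tens1r top2E /= !alg_mulE mul1r.
Qed.

Fact uea_counitr a : tmap idfun uea_counit (uea_comul a) = a ⊗ (1 : k^o).
Proof.
pose F : {linear U -> tensor U k^o} := tmap idfun uea_counit \o uea_comul.
pose G : {linear U -> tensor U k^o} := uea_tens1r.
apply: (@ulift_eq _ (top2 mU (alg_mul k^o)) F G) => [x||x y|x y] /=.
- rewrite uea_comul_gen !linearD /= !tmapE /= uea_counit_gen uea_counit1.
  by rewrite linear0r addr0.
- by rewrite uea_comul1 !tmapE /= uea_counit1.
- rewrite uea_comulM.
  by apply: tmap_top2 => u v; rewrite /= !alg_mulE ?uea_counitM.
- by rewrite /uea_tens1l /uea_tens1r top2E /= !alg_mulE mul1r.
Qed.

Fact uea_antipodel a :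
  mU (tmap uea_antipode idfun (uea_comul a)) = (uea_counit a : k) *: 1.
Proof.
pose L : {linear tensor U U -> U} := mU \o tmap uea_antipode idfun.
rewrite -[LHS]/(L (uea_comul a)).
have LE b b' : L (b ⊗ b') = uea_antipode b * b' by rewrite /= tmapE alg_mulE.
have LM s c : L s = c *: 1 -> forall t, L (top2 mU mU (s ⊗ t)) = c *: L t.
  move=> Ls; elim/tensor_ind=> [b b'|t t' IH IH']; last first.
    by rewrite linearDr linearD (linearD L) IH IH' linearD scalerDr.
  suff -> : L (top2 mU mU (s ⊗ (b ⊗ b'))) = uea_antipode b * L s * b'.
    by rewrite Ls LE -scalerAr mulr1 scalerAl.
  elim/tensor_ind: s {Ls} => [d d'|s s' IH IH'].
    by rewrite top2E !LE /= !alg_mulE uea_antipodeM !mulrA.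
  by rewrite linearDl linearD !(linearD L) IH IH' mulrDr mulrDl.
elim/uea_ind: a => [x||x y IHx IHy|x y IHx IHy|c x IHx].
- rewrite uea_comul_gen linearD !LE uea_antipode_gen uea_antipode1 uea_counit_gen.
  by rewrite mulr1 mul1r addNr scale0r.
- by rewrite uea_comul1 LE uea_antipode1 uea_counit1 mulr1 scale1r.
- by rewrite !linearD IHx IHy scalerDl.
- by rewrite uea_comulM (LM _ _ IHx) IHy uea_counitM scalerA.
- by rewrite !linearZ IHx /= scalerA.
Qed.

Fact uea_antipoder a :
  mU (tmap idfun uea_antipode (uea_comul a)) = (uea_counit a : k) *: 1.
Proof.
pose L : {linear tensor U U -> U} := mU \o tmap idfun uea_antipode.
rewrite -[LHS]/(L (uea_comul a)).
have LE b b' : L (b ⊗ b') = b * uea_antipode b' by rewrite /= tmapE alg_mulE.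
have LM t c : L t = c *: 1 -> forall s, L (top2 mU mU (s ⊗ t)) = c *: L s.
  move=> Lt; elim/tensor_ind=> [b b'|s s' IH IH']; last first.
    by rewrite linearDl linearD (linearD L) IH IH' linearD scalerDr.
  suff -> : L (top2 mU mU ((b ⊗ b') ⊗ t)) = b * L t * uea_antipode b'.
    by rewrite Lt LE -scalerAr mulr1 scalerAl.
  elim/tensor_ind: t {Lt} => [d d'|s s' IH IH'].
    by rewrite top2E !LE /= !alg_mulE uea_antipodeM !mulrA.
  by rewrite linearDr linearD !(linearD L) IH IH' mulrDr mulrDl.
elim/uea_ind: a => [x||x y IHx IHy|x y IHx IHy|c x IHx].
- rewrite uea_comul_gen linearD !LE uea_antipode_gen uea_antipode1 uea_counit_gen.
  by rewrite mulr1 mul1r subrr scale0r.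
- by rewrite uea_comul1 LE uea_antipode1 uea_counit1 mulr1 scale1r.
- by rewrite !linearD IHx IHy scalerDl.
- by rewrite uea_comulM (LM _ _ IHy) IHx uea_counitM scalerA mulrC.
- by rewrite !linearZ IHx /= scalerA.
Qed.

HB.instance Definition _ := Algebra_isHopf.Build k U
  uea_comulA uea_counitl uea_counitr uea_comul1 uea_comulM
  uea_counit1 uea_counitM uea_antipodel uea_antipoder.

End UeaHopf.

(* Main.v *)
Require Import Defs.
From HB Require Import structures.
From mathcomp Require Import all_boot all_algebra.
From mathcomp.classical Require Import boolp classical_sets.

(** Write [x], [y] for elements of the Lie algebra [g], hence primitive elements
    of [U = U(g)].  The compatibility of the bracket with the comultiplication,
    added to the same identity with the two arguments exchanged, gives
    [sum {a_1, b_1} ⊗ [a_2, b_2] + sum [a_1, b_1] ⊗ {a_2, b_2} = 0] for all [a]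
    and [b] ([poisson_hopf_comm]).  For [a = x ^ 2] and [b = y ^ 2] the left side
    is [4 ({x, y} ⊗ [x, y] + [x, y] ⊗ {x, y})], and as the characteristic is not 2,
    [{x, y} ⊗ [x, y] + [x, y] ⊗ {x, y} = 0] ([poisson_hopf_primitive]).  A linear
    functional equal to 1 on [[x, y]], if this is nonzero, then shows that [{x, y}] or [[x, y]]
    vanishes in [U] ([tens_sym_eq0]).

    Both are bilinear in [x] and [y], and a vector space is not the union of two
    proper subspaces; hence one of the two bilinear maps vanishes identically
    ([bilinear_or_eq0]).  It is not the commutator: a non-abelian [g] has a
    nonzero commutator in [U] ([ugen_lie_neq0]).  The injectivity of [g -> U],
    that is, the Poincare-Birkhoff-Witt theorem, is not needed for this: if all
    commutators vanished in [U], then the adjoint representation would show that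
    [g] is nilpotent of class at most 2, and such a [g] has an explicit
    representation in which [[x, y]] acts as zero only if it is zero.  So the
    bracket vanishes on [g], and on [U] by the Leibniz rule
    ([poisson_uea_eq0]). *)

Set Implicit Arguments.
Unset Strict Implicit.
Unset Printing Implicit Defensive.

Import GRing.Theory.
Local Open Scope ring_scope.

(** * Linear functionals and tensors *)

(** By Zorn's lemma there is a maximal subspace [W] avoiding [s].  It is a
    complement of the line spanned by [s]; the functional is the coordinate
    along [s]. *)
Lemma exists_functional (k : fieldType) (V : lmodType k) (s : V) :
  s != 0 -> exists f : {linear V -> k^o}, f s = 1.
Proof.
move=> s0.
pose sub (W : set V) := forall a x y, W x -> W y -> W (a *: x + y).
pose P (W : set V) := sub W /\ ~ W s.
have [W [[subW Ws] maxW]] : exists W, P W /\ forall B, (W `<` B)%classic -> ~ P B.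
  apply: Zorn_bigcup => F FP Ftot; split; last by move=> [A FA As]; case: (FP A FA).
  move=> a x y [A FA Ax] [B FB By].
  have [AB|BA] := Ftot _ _ FA FB.
    by exists B => //; apply: (proj1 (FP B FB)) => //; apply: AB.
  by exists A => //; apply: (proj1 (FP A FA)) => //; apply: BA.
(* [sub] does not require the zero vector, so that the union of the empty chain
   is covered; maximality excludes the empty set. *)
have W0 : W 0.
  apply: contrapT => nW0; apply: (maxW [set 0]%classic).
    rewrite properEneq; split.
      by apply/eqP => WE; apply: nW0; rewrite WE.
    by move=> x Wx; exfalso; apply: nW0; rewrite -(addNr x) -scaleN1r; apply: subW.
  split; last by move=> /= s0'; rewrite s0' eqxx in s0.
  by move=> a x y -> ->; rewrite scaler0 addr0.
have WZ a x : W x -> W (a *: x) by move=> Wx; rewrite -[_ *: _]addr0; apply: subW.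
have WD x y : W x -> W y -> W (x + y) by rewrite -{2}[x]scale1r; apply: subW.
have coordP v : exists c, W (v - c *: s).
  have [Wv|nWv] := pselect (W v); first by exists 0; rewrite scale0r subr0.
  (* Otherwise [W + k v] is larger than [W], hence contains [s]. *)
  pose B := [set w + a *: v | w in W & a in setT]%classic.
  have BE w a : W w -> B (w + a *: v) by move=> Ww; exists w => //; exists a.
  have Bs : B s.
    apply: contrapT => nBs; apply: (maxW B).
      rewrite properEneq; split.
        apply/eqP => WE; apply: nWv; rewrite WE -[v]add0r -[v in _ + v]scale1r.
        exact: BE.
      by move=> x Wx; rewrite -[x]addr0 -[0](scale0r v); apply: BE.
    split=> // a _ _ [w Ww [b _ <-]] [w' Ww' [b' _ <-]].
    rewrite scalerDr addrACA scalerA -scalerDl.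
    exact/BE/subW.
  case: Bs => w Ww [a _ sE].
  have a0 : a != 0.
    by apply: contra_notN Ws => /eqP a0; rewrite -sE a0 scale0r addr0.
  exists a^-1; rewrite -sE scalerDr scalerA mulVf // scale1r opprD addrCA subrr addr0.
  by rewrite -scaleNr; apply: WZ.
have coord_uniq v c c' : W (v - c *: s) -> W (v - c' *: s) -> c = c'.
  move=> Wc Wc'; apply/eqP; rewrite -subr_eq0; apply: contra_notT Ws => cc'.
  rewrite -[s]scale1r -(mulVf cc') -scalerA scalerBl; apply: WZ.
  suff -> : c *: s - c' *: s = (-1) *: (v - c *: s) + (v - c' *: s) by exact: subW.
  by rewrite scaleN1r opprB addrA subrK.
pose f v : k^o := projT1 (cid (coordP v)).
have fP v : W (v - f v *: s) by rewrite /f; case: cid.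
have flin : linear f.
  move=> a x y; apply: (coord_uniq (a *: x + y)); first exact: fP.
  have -> : a *: x + y - (a *: f x + f y) *: s
      = a *: (x - f x *: s) + (y - f y *: s).
    by rewrite scalerDl opprD addrACA scalerBr scalerA.
  exact: subW.
pose F : {linear V -> k^o} := HB.pack f (GRing.isLinear.Build k V k^o *:%R f flin).
exists F; apply: (coord_uniq s); first exact: fP.
by rewrite scale1r subrr.
Qed.

Section Contract.
Variables (k : fieldType) (V : lmodType k) (f : {linear V -> k^o}).

(** Contraction of the first tensor factor by a functional. *)
Definition contract_fun (v w : V) : V := (f v : k) *: w.

Fact contract_bilinear : bilinear_for *:%R *:%R contract_fun.
Proof.
split=> [w a v v'|v a w w']; rewrite /contract_fun.
  by rewrite linearP scalerDl; congr (_ + _); apply/esym/scalerA.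
rewrite scalerDr; congr (_ + _).
by apply: etrans (esym (scalerA _ _ _)); rewrite mulrC; apply: scalerA.
Qed.

HB.instance Definition _ := bilinear_isBilinear.Build k V V V *:%R *:%R
  contract_fun contract_bilinear.

End Contract.

Lemma tens_sym_eq0 (k : fieldType) (V : lmodType k) (u s : V) :
    2%N \notin [pchar k] -> u ⊗ s + s ⊗ u = 0 -> u = 0 \/ s = 0.
Proof.
move=> k2 us0; have [->|s0] := eqVneq s 0; [by right | left].
have [f fs] := exists_functional s0.
(* Contract the first factor by [f]. *)
have uE : u = - (f u : k) *: s.
  move: (congr1 (tlift (contract_fun f)) us0).
  rewrite linear0 linearD /= !tliftE /= /contract_fun fs scale1r => /eqP.
  by rewrite addrC addr_eq0 scaleNr => /eqP.
have : (f u : k) *+ 2 = 0.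
  have : (f u : k) = - f u by rewrite {1}uE linearZ /= fs [_ *: _]mulr1.
  by move=> /eqP; rewrite -addr_eq0 -mulr2n => /eqP.
move/eqP; rewrite -mulr_natr mulf_eq0 => /orP[/eqP fu0|two0].
  by rewrite uE fu0 oppr0 scale0r.
by case/negP: k2; rewrite inE two0.
Qed.

(** * Brackets and commutators in a Poisson Hopf algebra *)

Section Commutator.
Variables (k : fieldType) (A : algType k).

(** The commutator of an algebra. *)
Definition alg_comm_fun (a b : A) : A := a * b - b * a.

Fact alg_comm_bilinear : bilinear_for *:%R *:%R alg_comm_fun.
Proof.
split=> [b c a a'|a c b b']; rewrite /alg_comm_fun.
  by rewrite mulrDl mulrDr -scalerAl -scalerAr opprD addrACA -scalerBr.
by rewrite mulrDl mulrDr -scalerAl -scalerAr opprD addrACA -scalerBr.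
Qed.

HB.instance Definition _ := bilinear_isBilinear.Build k A A A *:%R *:%R
  alg_comm_fun alg_comm_bilinear.

(** The commutator as a linear map on the tensor square. *)
Definition alg_comm : tensor A A -> A := tlift alg_comm_fun.

HB.instance Definition _ := GRing.Linear.on alg_comm.

Lemma alg_commE a b : alg_comm (a ⊗ b) = a * b - b * a.
Proof. exact: tliftE. Qed.

End Commutator.

Arguments alg_comm {k} A.

Section PoissonAlgebra.
Variables (k : fieldType) (A : algType k) (br : {linear tensor A A -> A}).
Hypothesis brP : is_poisson br.

Lemma poisson_anti a b : br (b ⊗ a) = - br (a ⊗ b).
Proof.
have [alt _] := poisson_lie brP.
have := alt (a + b); rewrite linearDl !linearDr !linearD /= !alt add0r addr0.
by move/eqP; rewrite addrC addr_eq0 => /eqP.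
Qed.

Lemma poisson1l c : br (1 ⊗ c) = 0.
Proof.
have := poisson_leibniz brP 1 1 c; rewrite mul1r mul1r mulr1 => /esym /eqP.
by rewrite -[X in _ == X]addr0 (inj_eq (addrI _)) => /eqP.
Qed.

Lemma poisson1r c : br (c ⊗ 1) = 0.
Proof. by rewrite poisson_anti poisson1l oppr0. Qed.

(** The product operation [br ⊗ mul] on the tensor square is not antisymmetric:
    its symmetrization is [br ⊗ comm]. *)
Lemma top2_br_symm (s t : tensor A A) :
  top2 br (alg_mul A) (s ⊗ t) + top2 br (alg_mul A) (t ⊗ s)
    = top2 br (alg_comm A) (s ⊗ t).
Proof.
move: s t; apply: tensor_ind2=> [a b a' b'|s s' t IH IH'|s t t' IH IH'].
- rewrite !top2E /= !alg_mulE alg_commE (poisson_anti a a').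
  by rewrite linearNl linearBr.
- by rewrite !(linearDl, linearDr, linearD) /= addrACA IH IH'.
- by rewrite !(linearDl, linearDr, linearD) /= addrACA IH IH'.
Qed.

Lemma top2_mul_symm (s t : tensor A A) :
  top2 (alg_mul A) br (s ⊗ t) + top2 (alg_mul A) br (t ⊗ s)
    = top2 (alg_comm A) br (s ⊗ t).
Proof.
move: s t; apply: tensor_ind2=> [a b a' b'|s s' t IH IH'|s t t' IH IH'].
- rewrite !top2E /= !alg_mulE alg_commE (poisson_anti b b').
  by rewrite linearNr linearBl.
- by rewrite !(linearDl, linearDr, linearD) /= addrACA IH IH'.
- by rewrite !(linearDl, linearDr, linearD) /= addrACA IH IH'.
Qed.

End PoissonAlgebra.

Section PoissonHopf.
Variables (k : fieldType) (H : hopfAlgType k) (br : {linear tensor H H -> H}).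
Hypothesis brP : is_poisson_hopf br.

Let brA : is_poisson br := poisson_hopf_poisson brP.

(** The bracket on the tensor square prescribed by the compatibility of [br]
    with the comultiplication is not antisymmetric in general; it must be so on
    the image of the comultiplication. *)
Lemma poisson_hopf_comm (a b : H) :
  top2 br (alg_comm H) (comul a ⊗ comul b)
    + top2 (alg_comm H) br (comul a ⊗ comul b) = 0.
Proof.
rewrite -(top2_br_symm brA) -(top2_mul_symm brA) addrACA.
rewrite -!(poisson_hopf_comul brP) (poisson_anti brA a b).
by rewrite linearN subrr.
Qed.

(** Primitive elements of a Hopf algebra. *)
Definition primitive (x : H) := comul x = x ⊗ 1 + 1 ⊗ x.

Lemma primitive_comul_sqr x : primitive x ->
  comul (x * x) = (x * x) ⊗ 1 + 1 ⊗ (x * x) + (x ⊗ x) *+ 2.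
Proof.
move=> xP; rewrite comulM xP !(linearDl, linearDr, linearD) /= !top2E /= !alg_mulE.
by rewrite !mulr1 !mul1r mulr2n [X in _ + X]addrC addrACA.
Qed.

(** This is [poisson_hopf_comm] for the squares of two primitive elements. *)
Lemma poisson_hopf_primitive x y : primitive x -> primitive y ->
    2%N \notin [pchar k] ->
  br (x ⊗ y) ⊗ (x * y - y * x) + (x * y - y * x) ⊗ br (x ⊗ y) = 0.
Proof.
move=> xP yP k2.
have br1l := poisson1l brA; have br1r := poisson1r brA.
have comm1l (a : H) : alg_comm H (1 ⊗ a) = 0.
  by rewrite alg_commE mulr1 mul1r subrr.
have comm1r (a : H) : alg_comm H (a ⊗ 1) = 0.
  by rewrite alg_commE mulr1 mul1r subrr.
(* The terms with a factor 1 vanish; only [x ⊗ x] and [y ⊗ y], each of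
   coefficient 2, contribute. *)
have simp (f g : {linear tensor H H -> H}) :
    (forall a, f (1 ⊗ a) = 0) -> (forall a, f (a ⊗ 1) = 0) ->
    (forall a, g (1 ⊗ a) = 0) -> (forall a, g (a ⊗ 1) = 0) ->
  top2 f g (comul (x * x) ⊗ comul (y * y)) = (f (x ⊗ y) ⊗ g (x ⊗ y)) *+ 4.
  move=> f1l f1r g1l g1r; rewrite !primitive_comul_sqr // !mulr2n.
  rewrite !(linearDl, linearDr, linearD) /= !top2E /= !(f1l, f1r, g1l, g1r).
  by rewrite !(linear0l, linear0r, addr0, add0r) -!mulr2n -mulrnA.
have := poisson_hopf_comm (x * x) (y * y).
rewrite !simp //= ?alg_commE.
rewrite -mulrnDl -scaler_nat => /eqP; rewrite scaler_eq0 => /orP[|/eqP //].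
by rewrite (natrM _ 2 2) mulf_eq0 orbb => two0; case/negP: k2; rewrite inE two0.
Qed.

End PoissonHopf.

(** * Representations of enveloping algebras *)

Section UeaRepr.
Variables (k : fieldType) (g : lieAlgType k) (M : lmodType k).
Variable rho : {bilinear g -> M -> M}.
Hypothesis rho_lie : forall x y v,
  rho (lie x y) v = rho x (rho y v) - rho y (rho x v).

(** The action on [M] of a formal expression in elements of [g], extending the
    representation [rho]. *)
Fixpoint uact (t : uterm g) (v : M) : M :=
  match t with
  | UGen x => rho x v
  | UOne => v
  | UAdd s t => uact s v + uact t v
  | UMul s t => uact s (uact t v)
  | UScale a t => a *: uact t v
  end.

Lemma uact_linear t : linear (uact t).
Proof.
elim: t => /= [x||s IHs t IHt|s IHs t IHt|b t IHt] a u v.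
- by rewrite linearDr linearZr_LR.
- by [].
- by rewrite IHs IHt scalerDr addrACA.
- by rewrite IHt IHs.
- by rewrite IHt scalerDr !scalerA mulrC.
Qed.

Lemma uact_eq s t : ueq s t -> uact s =1 uact t.
Proof.
have uactD r : {morph uact r : u v / u + v}.
  by move=> u v; have := uact_linear r 1 u v; rewrite !scale1r.
have uact0 r : uact r 0 = 0.
  by have := uact_linear r (-1) 0 0; rewrite scaler0 addr0 scaleN1r addNr.
have uactZ r a u : uact r (a *: u) = a *: uact r u.
  by have := uact_linear r a u 0; rewrite uact0 !addr0.
elim=> //= {s t}.
- by move=> s t _ IH v; rewrite IH.
- by move=> s t u _ IH _ IH' v; rewrite IH IH'.
- by move=> s s' t t' _ IH _ IH' v; rewrite IH IH'.
- by move=> s s' t t' _ IH _ IH' v; rewrite IH IH'.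
- by move=> a t t' _ IH v; rewrite IH.
- by move=> s t u v; rewrite addrA.
- by move=> s t v; rewrite addrC.
- by move=> a b t v; rewrite scalerA.
- by move=> t v; rewrite scale1r.
- by move=> t v; rewrite !scale0r.
- by move=> a s t v; rewrite scalerDr.
- by move=> a b t v; rewrite scalerDl.
- by move=> r s t v; rewrite uactD.
- by move=> a s t v; rewrite uactZ.
- by move=> x y v; rewrite linearDl.
- by move=> a x v; rewrite linearZl_LR.
- by move=> x y v; rewrite rho_lie scaleN1r.
Qed.

(** A Lie algebra representation extends to the enveloping algebra, so it
    vanishes on the elements killed by [ugen]. *)
Lemma ugen_eq0_repr x : ugen x = 0 -> forall v, rho x v = 0.
Proof.
rewrite -[0](scale0r 1) -upi1 -upiZ => /upiP /uact_eq /= x0 v.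
by rewrite x0 scale0r.
Qed.

End UeaRepr.

Section UgenNonabelian.
Variables (k : fieldType) (g : lieAlgType k).

Lemma lie_anti (x y : g) : lie y x = - lie x y.
Proof.
have [alt _] := @lieP k g.
have := alt (x + y); rewrite linearDl !linearDr /= !alt add0r addr0.
by move/eqP; rewrite addrC addr_eq0 => /eqP.
Qed.

Lemma lie_adjoint (x y z : g) :
  lie (lie x y) z = lie x (lie y z) - lie y (lie x z).
Proof.
have [_ jac] := @lieP k g.
have /eqP := jac x y z; rewrite (lie_anti (lie x y) z) subr_eq0 => /eqP <-.
by rewrite (lie_anti x z) linearNr.
Qed.

(** The action [x . (c, y) = (0, c x + [x, y] / 2)] of [g] on [k * g]: when [g] is
    nilpotent of class at most 2, [k * g] is a unital associative algebra for the
    product [x y = [x, y] / 2] on [g], whose commutator is the Lie bracket, and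
    this is left multiplication. *)
Definition nil2_act (x : g) (v : k^o * g) : k^o * g :=
  (0, (v.1 : k) *: x + 2^-1 *: lie x v.2).

Fact nil2_act_bilinear : bilinear_for *:%R *:%R nil2_act.
Proof.
split=> [[c y] a x x'|x a [c y] [c' y']]; rewrite /nil2_act; congr pair => /=.
- by rewrite scaler0 addr0.
- rewrite linearDl linearZl_LR !scalerDr !scalerA addrACA.
  by rewrite (mulrC c) (mulrC a 2^-1).
- by rewrite scaler0 addr0.
- rewrite linearDr linearZr_LR !scalerDr scalerDl !scalerA addrACA.
  by rewrite (mulrC a 2^-1).
Qed.

HB.instance Definition _ := bilinear_isBilinear.Build k g (k^o * g)%type
  (k^o * g)%type *:%R *:%R nil2_act nil2_act_bilinear.

(** A non-abelian Lie algebra has a noncommutative enveloping algebra. *)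
Lemma ugen_lie_neq0 : 2%N \notin [pchar k] -> ~ lie_abelian g ->
  exists x y : g, ugen (lie x y) <> 0.
Proof.
move=> k2 nab; apply: contrapT => /forallNP ugen0; apply: nab => x0 y0.
have {}ugen0 (x y : g) : ugen (lie x y) = 0.
  by have /forallNP/(_ y) := ugen0 x; apply: contrapT.
(* In the adjoint representation every [lie x y] acts as zero. *)
have nil2 (x y z : g) : lie (lie x y) z = 0.
  by apply: (ugen_eq0_repr lie_adjoint).
have nil2r (x y z : g) : lie z (lie x y) = 0 by rewrite lie_anti nil2 oppr0.
have two0 : (2 : k) != 0 by apply: contra k2 => two0; rewrite inE two0.
have nil2_lie (x y : g) v :
    nil2_act (lie x y) v = nil2_act x (nil2_act y v) - nil2_act y (nil2_act x v).
  case: v => c z; rewrite /nil2_act; congr pair => /=; first by rewrite subrr.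
  rewrite nil2 scaler0 addr0 !scale0r !add0r !linearDr !linearZr_LR /=.
  rewrite !nil2r !scaler0 !addr0 (lie_anti x y) !scalerN opprK.
  by rewrite -mulr2n -scaler_nat scalerA divff // scale1r.
(* [z . (1, 0) = (0, z)], so the action of [z] determines [z]. *)
have := ugen_eq0_repr nil2_lie (ugen0 x0 y0) (1, 0).
by rewrite /= /nil2_act /= nil2 scaler0 addr0 scale1r => -[].
Qed.

End UgenNonabelian.

(** * Vanishing of the bracket *)

(** A group is not the union of two proper subgroups, here the kernels of [p]
    and [q]. *)
Lemma linear_or_eq0 (k : fieldType) (V W W' : lmodType k)
    (p : {linear V -> W}) (q : {linear V -> W'}) :
  (forall x, p x = 0 \/ q x = 0) -> (forall x, p x = 0) \/ (forall x, q x = 0).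
Proof.
move=> pq; have [|/existsNP[x px]] := pselect (forall x, p x = 0); first by left.
right=> y; have qx : q x = 0 by case: (pq x).
have [py|//] := pq y; have [pxy|] := pq (x + y).
  by case: px; rewrite -pxy linearD py addr0.
by rewrite linearD qx add0r.
Qed.

(** For each [x], one of [p x] and [q x] is identically zero; then the same
    argument applies to the variable [x]. *)
Lemma bilinear_or_eq0 (k : fieldType) (V V' W W' : lmodType k)
    (p : {bilinear V -> V' -> W}) (q : {bilinear V -> V' -> W'}) :
    (forall x y, p x y = 0 \/ q x y = 0) ->
  (forall x y, p x y = 0) \/ (forall x y, q x y = 0).
Proof.
move=> pq.
have row x : (forall y, p x y = 0) \/ (forall y, q x y = 0).
  exact: (@linear_or_eq0 _ _ _ _ (p x) (q x)) (pq x).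
have [|/existsNP[x /existsNP[y pxy]]] := pselect (forall x y, p x y = 0).
  by left.
right=> x' y'; have qx : forall y, q x y = 0 by case: (row x).
have [px'|//] := row x'; have [pxx'|qxx'] := row (x + x').
  by case: pxy; have := pxx' y; rewrite linearDl px' addr0.
by have := qxx' y'; rewrite linearDl qx add0r.
Qed.

Section GenBracket.
Variables (k : fieldType) (g : lieAlgType k).
Variable br : {linear tensor (uea g) (uea g) -> uea g}.

(** The Poisson bracket on [g], with values in the enveloping algebra. *)
Definition gen_br (x y : g) : uea g := br (ugen x ⊗ ugen y).

Fact gen_br_bilinear : bilinear_for *:%R *:%R gen_br.
Proof.
split=> [y a x x'|x a y y']; rewrite /gen_br.
  by rewrite linearP linearDl linearZl_LR linearP.
by rewrite linearP linearDr linearZr_LR linearP.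
Qed.

HB.instance Definition _ := bilinear_isBilinear.Build k g g (uea g)
  *:%R *:%R gen_br gen_br_bilinear.

(** The Lie bracket, with values in the enveloping algebra. *)
Definition gen_lie (x y : g) : uea g := ugen (lie x y).

Fact gen_lie_bilinear : bilinear_for *:%R *:%R gen_lie.
Proof.
split=> [y a x x'|x a y y']; rewrite /gen_lie.
  by rewrite linearDl linearZl_LR linearP.
by rewrite linearDr linearZr_LR linearP.
Qed.

HB.instance Definition _ := bilinear_isBilinear.Build k g g (uea g)
  *:%R *:%R gen_lie gen_lie_bilinear.

(** By the Leibniz rule, a Poisson bracket on the enveloping algebra is
    determined by its values on [g]. *)
Lemma poisson_uea_eq0 : is_poisson br ->
  (forall x y, br (ugen x ⊗ ugen y) = 0) -> forall z, br z = 0.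
Proof.
move=> brP br0.
have ext c : (forall x, br (ugen x ⊗ c) = 0) -> forall a, br (a ⊗ c) = 0.
  move=> brc; elim/uea_ind=> //.
  - exact: poisson1l.
  - by move=> x y IHx IHy; rewrite linearDl linearD /= IHx IHy addr0.
  - by move=> x y IHx IHy; rewrite (poisson_leibniz brP) IHx IHy mulr0 mul0r addr0.
  - by move=> a x IHx; rewrite linearZl_LR linearZ /= IHx scaler0.
elim/tensor_ind=> [a b|z z' IH IH']; last by rewrite linearD IH IH' addr0.
apply: (ext b) => x; rewrite (poisson_anti brP) (ext (ugen x)) ?oppr0 //.
Qed.

End GenBracket.

Theorem proposition2p5 (k : fieldType) (g : lieAlgType k)
    (k_char : 2%N \notin [pchar k]) (g_nonabelian : ~ lie_abelian g)
    (br : {linear tensor (uea g) (uea g) -> uea g})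
    (br_poisson_hopf : is_poisson_hopf br) :
  forall x : tensor (uea g) (uea g), br x = 0.
Proof.
have brA := poisson_hopf_poisson br_poisson_hopf.
apply: poisson_uea_eq0 => //.
(* The commutator of two generators in [uea g] is [ugen (lie x y)]. *)
have alt (x y : g) : gen_br br x y = 0 \/ gen_lie x y = 0.
  apply: tens_sym_eq0 => //; rewrite /gen_lie ugen_lie.
  by apply: poisson_hopf_primitive => //; apply: uea_comul_gen.
have [//|lie0] := bilinear_or_eq0 alt.
have [x [y]] := ugen_lie_neq0 k_char g_nonabelian.
by case; apply: lie0.
Qed.
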